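(* Let $n\ge3$ and $C_S(n):=\frac{4(n-1)}{\sqrt{n}(n-2)}$ (which satisfies $C_S(n)\le5$). For every mesh size vector $h$, $$\|u\|_{L^{\frac{2n}{n-2}}}\le C_S(n)\|u\|_D\quad\text{for all }u\in D^{1,2}(\mathbb{R}^n_h).$$
   Context: $h=(h_1,\dots,h_n)$, $h_i>0$, $\mathbb{R}^n_h=\{(h_1z_1,\dots,h_nz_n):z_i\in\mathbb{Z}\}$, $\mathbf{h}=h_1\cdots h_n$, $D_i^+u(x)=(u(x+h_ie_i)-u(x))/h_i$. For $u:\mathbb{R}^n_h\to\mathbb{R}$: $\|u\|_{L^r}=(\sum_{x\in\mathbb{R}^n_h}|u(x)|^r\mathbf{h})^{1/r}$, $\|u\|_D=(\sum_{i=1}^n\sum_{x\in\mathbb{R}^n_h}|D_i^+u(x)|^2\mathbf{h})^{1/2}$. $D^{1,2}(\mathbb{R}^n_h)=\{u:\mathbb{R}^n_h\to\mathbb{R}:\|u\|_{L^{2n/(n-2)}}<\infty,\ \|u\|_D<\infty\}$. *)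

(* Defs.v *)
From HB Require Import structures.
From mathcomp Require Import all_boot all_order all_algebra.
From mathcomp Require Import all_classical all_reals all_analysis.
Set Implicit Arguments. Unset Strict Implicit. Unset Printing Implicit Defensive.
Import Order.TTheory GRing.Theory Num.Theory.
Local Open Scope ring_scope.
Local Open Scope classical_set_scope.

Section DiscreteSobolev.
Context {R : realType} {n : nat}.

Definition zpoint := {ffun 'I_n -> int}.

Definition lpt (h : 'I_n -> R) (z : zpoint) : 'I_n -> R :=
  fun i => h i * (z i)%:~R.

Definition hvol (h : 'I_n -> R) : R := \prod_(i < n) h i.

Definition Dplus (h : 'I_n -> R) (u : ('I_n -> R) -> R) (i : 'I_n)
  (x : 'I_n -> R) : R :=
  (u (fun j => x j + (if j == i then h i else 0)) - u x) / h i.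

Definition lattice_Lnorm (h : 'I_n -> R) (u : ('I_n -> R) -> R) (r : R)
  : \bar R :=
  poweR (\esum_(z in [set: zpoint]) ((`|u (lpt h z)| `^ r * hvol h)%:E))
        r^-1.

Definition lattice_Dnorm (h : 'I_n -> R) (u : ('I_n -> R) -> R) : \bar R :=
  poweR (\sum_(i < n)
           \esum_(z in [set: zpoint])
              ((`|Dplus h u i (lpt h z)| ^+ 2 * hvol h)%:E))%E
        (2^-1).

Definition sob_exp : R := (2 * n%:R) / (n%:R - 2).

Definition in_D12 (h : 'I_n -> R) (u : ('I_n -> R) -> R) : Prop :=
  (lattice_Lnorm h u sob_exp < +oo)%E /\ (lattice_Dnorm h u < +oo)%E.

Definition C_S : R := (4 * (n%:R - 1)) / (Num.sqrt n%:R * (n%:R - 2)).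

End DiscreteSobolev.

(* Main.v *)
Require Import Defs.
From HB Require Import structures.
From mathcomp Require Import all_boot all_order all_algebra.
From mathcomp Require Import all_classical all_reals all_analysis.
From mathcomp Require Import ring lra.
Set Implicit Arguments. Unset Strict Implicit. Unset Printing Implicit Defensive.
Import Order.TTheory GRing.Theory Num.Theory.
Local Open Scope ring_scope.
Local Open Scope classical_set_scope.

(** The exponents are [p = 2n/(n-2)] and [g = 2(n-1)/(n-2)], so that
    [g * n/(n-1) = 2(g-1) = p]. Apply the discrete Gagliardo-Nirenberg inequality
    in [l^1] to [v = |u|^g]: since [v] tends to [0] along each lattice line, [v z]
    is at most the sum of [|v (y + e_i) - v y|] over the line through [z] in any
    direction [i], and the Loomis-Whitney argument bounds
    [sum v^(n/(n-1)) = sum |u|^p =: S] by the product over [i] of the [1/(n-1)]-th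
    powers of [sum |v (z + e_i) - v z|]. By the tangent line inequality for [t^g]
    and Cauchy-Schwarz, each of these sums is at most
    [2 g S^(1/2) (sum |u (z + e_i) - u z|^2)^(1/2)]. Solving for [S] (finite on
    [D^{1,2}]), the mesh sizes recombine into [hvol h], and the AM-GM inequality
    over the directions gives the constant [2 g / sqrt n = C_S]. *)

(** * Arithmetic and geometric means of finitely many reals *)

Lemma powR_prod (R : realType) (I : finType) (P : pred I) (x : I -> R) (c : R) :
  (forall i, P i -> 0 <= x i) ->
  \prod_(i | P i) x i `^ c = (\prod_(i | P i) x i) `^ c.
Proof.
move=> x0; have [] // : \prod_(i | P i) x i `^ c = (\prod_(i | P i) x i) `^ c /\
    0 <= \prod_(i | P i) x i.
apply: (big_ind2 (fun a b => a = b `^ c /\ 0 <= b)); first by rewrite powR1.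
  by move=> a b d e [-> b0] [-> e0]; rewrite powRM// mulr_ge0.
by move=> i /x0 xi0.
Qed.

(** AM-GM with the root taken on each factor, the shape in which the products of powers occur
    below. *)
Lemma geomean_le_mean (R : realType) (I : finType) (A : {pred I}) (x : I -> R) :
  (0 < #|A|)%N -> (forall i, i \in A -> 0 <= x i) ->
  \prod_(i in A) x i `^ (#|A|%:R^-1) <= (\sum_(i in A) x i) / #|A|%:R.
Proof.
move=> A0 x0; rewrite powR_prod//; set m := leRHS.
have [le _] := leif_AGM x0; rewrite -/m in le.
have m0 : 0 <= m by rewrite divr_ge0// sumr_ge0.
have An0 : #|A|%:R != 0 :> R by rewrite pnatr_eq0 -lt0n.
have -> : m = (m ^+ #|A|) `^ (#|A|%:R^-1).
  by rewrite -powR_mulrn// -powRrM mulfV// powRr1.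
by apply: (ge0_ler_powR _ _ _ le); rewrite ?invr_ge0// nnegrE ?exprn_ge0// prodr_ge0.
Qed.

(** * Sums of nonnegative extended reals and Hölder's inequality with equal exponents *)

Section Esum.
Context {R : realType}.

(** Each finite partial sum scales exactly, and the bound passes to the supremum; this direction
    also covers [c = +oo]. *)
Lemma ge0_esumZl_le (T : choiceType) (D : set T) (c : \bar R) (f : T -> \bar R) :
  (0 <= c)%E -> (forall t, (0 <= f t)%E) ->
  (\esum_(t in D) (c * f t) <= c * \esum_(t in D) f t)%E.
Proof.
move=> c0 f0; apply: ge_ereal_sup => _ [X [finX XD] <-].
rewrite -ge0_mule_fsumr// lee_wpmul2l// ereal_sup_ubound//; by exists X.
Qed.

Lemma esum_subset_le (T : choiceType) (D E : set T) (f : T -> \bar R) :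
  D `<=` E -> (\esum_(t in D) f t <= \esum_(t in E) f t)%E.
Proof.
move=> DE; apply: ge_ereal_sup => _ [X [finX XD] <-].
by apply: ereal_sup_ubound; exists X => //; split => //; exact: subset_trans DE.
Qed.

Lemma ge0_esum_bigcup (T K : choiceType) (D : set K) (J : K -> set T)
    (f : T -> \bar R) : trivIset D J -> (forall t, (0 <= f t)%E) ->
  (\esum_(t in \bigcup_(k in D) J k) f t =
   \esum_(k in D) \esum_(t in J k) f t)%E.
Proof.
move=> tJ f0; rewrite esum_esum//.
rewrite (reindex_esum (D `*`` J) _ snd)//; split.
- by move=> [k t] /= [Dk Jt]; exists k.
- move=> [k t] [k' t'] /set_mem[/= Dk Jt] /set_mem[/= Dk' Jt'] tt'.
  by subst t'; rewrite (tJ k k')//; exists t.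
- by move=> t [k Dk Jt]; exists (k, t).
Qed.

Lemma le_term_esum (T : choiceType) (D : set T) (f : T -> \bar R) t :
  (forall t, (0 <= f t)%E) -> D t -> (f t <= \esum_(t in D) f t)%E.
Proof.
move=> f0 Dt; rewrite -(esum_set1 (f0 t)); apply: esum_subset_le.
by move=> _ ->.
Qed.

Lemma lee_prod (I : finType) (P : pred I) (f g : I -> \bar R) :
  (forall i, P i -> (0 <= f i <= g i)%E) ->
  (\prod_(i | P i) f i <= \prod_(i | P i) g i)%E.
Proof.
move=> fg; have [] // : (0 <= \prod_(i | P i) f i)%E /\
  (\prod_(i | P i) f i <= \prod_(i | P i) g i)%E.
apply: (big_ind2 (fun a b => (0 <= a)%E /\ (a <= b)%E)); first by rewrite lee01.
  by move=> a b d e [a0 ab] [d0 de]; rewrite mule_ge0// lee_pmul.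
by move=> i /fg /andP[].
Qed.

(* The values [0] and [+oo] are treated apart because [0 * +oo = 0] in [\bar R]. *)
Lemma esum_geomean_le (T : choiceType) (D : set T) (I : finType)
    (A : {pred I}) (a : I -> T -> \bar R) :
  (0 < #|A|)%N -> (forall i t, (0 <= a i t)%E) ->
  (\esum_(t in D) \prod_(i in A) poweR (a i t) (#|A|%:R^-1) <=
   \prod_(i in A) poweR (\esum_(t in D) a i t) (#|A|%:R^-1))%E.
Proof.
move=> A0 a0; set c : R := #|A|%:R^-1.
have c0 : 0 < c by rewrite invr_gt0 ltr0n.
have S0 i : (0 <= \esum_(t in D) a i t)%E by exact: esum_ge0.
case: (pselect (exists2 i, i \in A & \esum_(t in D) a i t = 0%E)) => [[i iA Si]|].
  rewrite esum1; first by apply: prode_ge0 => *; exact: poweR_ge0.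
  move=> t Dt; rewrite (bigD1 i)//=.
  suff -> : a i t = 0%E by rewrite poweR0r ?mul0e// gt_eqF.
  by apply/eqP; rewrite eq_le a0 andbT -Si le_term_esum.
move=> /forall2NP Sn0.
have Sgt0 i : i \in A -> (0 < \esum_(t in D) a i t)%E.
  by move=> iA; rewrite lt0e S0 andbT; apply/eqP; case: (Sn0 i).
case: (pselect (exists2 i, i \in A & \esum_(t in D) a i t = +oo%E)) => [[i iA Si]|].
  rewrite (bigD1 i)//= Si poweRyr ?gt_eqF// gt0_mulye ?leey//.
  apply: (big_ind (fun x => (0 < x)%E)) => //; first exact: mule_gt0.
  by move=> j /andP[jA _]; rewrite poweR_gt0// Sgt0.
move=> /forall2NP Sny.
have Sfin i : i \in A -> \esum_(t in D) a i t \is a fin_num.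
  by move=> iA; rewrite ge0_fin_numE// ltey; apply/eqP; case: (Sny i).
pose s i := fine (\esum_(t in D) a i t).
have sE i : i \in A -> \esum_(t in D) a i t = (s i)%:E by move=> iA; rewrite fineK ?Sfin.
have s_gt0 i : i \in A -> 0 < s i by move=> iA; rewrite -lte_fin -sE// Sgt0.
under [leRHS]eq_bigr => i iA do rewrite sE// poweR_EFin.
rewrite prodEFin; set P := \prod_(i in A) _.
have P0 : 0 <= P by apply: prodr_ge0 => *; exact: powR_ge0.
(* Dividing each [a i] by its total [s i] turns pointwise AM-GM into a bound that is linear in the
   [a i t] and can be summed over [t]; [P] undoes the normalization. *)
have key t : D t -> (\prod_(i in A) poweR (a i t) c <=
    P%:E * \sum_(i in A) ((c / s i)%:E * a i t))%E.
  move=> Dt.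
  have afin i : i \in A -> a i t = (fine (a i t))%:E.
    move=> iA; rewrite fineK// ge0_fin_numE//.
    by rewrite (le_lt_trans (le_term_esum (a0 i) Dt))// sE// ltry.
  under eq_bigr => i iA do rewrite afin// poweR_EFin.
  rewrite prodEFin.
  under [X in (_ <= _ * X)%E]eq_bigr => i iA do rewrite afin// -EFinM.
  rewrite sumEFin -EFinM lee_fin.
  have b0 i : i \in A -> 0 <= fine (a i t) / s i.
    by move=> iA; rewrite divr_ge0// ?fine_ge0// ltW// s_gt0.
  have := geomean_le_mean A0 b0; rewrite -/c => /(ler_wpM2l P0).
  rewrite -big_split/= => /le_trans H.
  rewrite [leLHS](_ : _ = \prod_(i in A) (s i `^ c * (fine (a i t) / s i) `^ c)).
    apply: H; rewrite ler_wpM2l// mulr_suml ler_sum// => i iA.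
    by rewrite -/c -mulrA mulrC [_^-1 * _]mulrC.
  apply: eq_bigr => i iA; rewrite -powRM ?b0 ?(ltW (s_gt0 _ _))// mulrC divfK//.
  by rewrite gt_eqF// s_gt0.
apply: (le_trans (le_esum key)).
apply: (le_trans (ge0_esumZl_le _ _ _)); first by rewrite lee_fin.
  move=> t; apply: sume_ge0 => i iA; rewrite mule_ge0// lee_fin divr_ge0// ltW//.
  exact: s_gt0.
rewrite -[leRHS]mule1 lee_wpmul2l ?lee_fin// esum_sum; last first.
  by move=> t i _ iA; rewrite mule_ge0// lee_fin divr_ge0// ltW// s_gt0.
(* Each normalized sum contributes at most [c = 1/#|A|], and these add up to [1]. *)
rewrite (@le_trans _ _ (\sum_(i in A) c%:E)%E)//.
  apply: lee_sum => i iA; apply: (le_trans (ge0_esumZl_le _ _ _)) => //.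
    by rewrite lee_fin divr_ge0// ltW// s_gt0.
  by rewrite sE// -EFinM divfK// gt_eqF// s_gt0.
rewrite sumEFin lee_fin sumr_const -mulr_natl mulfV// gt_eqF//.
by rewrite ltr0n.
Qed.

End Esum.

(** * The Loomis-Whitney inequality *)

Section LoomisWhitney.
Context {R : realType} {I : finType} {K : choiceType}.
Implicit Types (A B : {set I}) (x y z : {ffun I -> K}).

(** The coordinate subspace through [z] in the directions of [A]. Its elements remain full functions
    on [I], so slices in different directions live in one type. *)
Definition slice A z : set {ffun I -> K} :=
  [set y | forall j, j \notin A -> y j = z j].

Lemma slice_set0 z : slice finset.set0 z = [set z].
Proof.
apply/seteqP; split=> [y yz|_ -> //]; apply/ffunP => j.
by rewrite yz// finset.inE.
Qed.

Lemma slice_setT z : slice [set: I]%SET z = [set: {ffun I -> K}].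
Proof. by apply/seteqP; split=> // y _ j; rewrite finset.inE. Qed.

Lemma slice_eq A y z : slice A z y -> slice A y = slice A z.
Proof.
move=> yz; apply/seteqP; split=> x xy j jA; first by rewrite xy// yz.
by rewrite xy// -yz.
Qed.

(** Fubini: a point of the large slice lies over a unique [y], the one that agrees with it on [A]
    and with [z] elsewhere. Uniqueness uses that [A] and [B] are disjoint. *)
Lemma esum_sliceU A B z (f : {ffun I -> K} -> \bar R) :
  {in A, forall j, j \notin B} -> (forall x, (0 <= f x)%E) ->
  \esum_(x in slice (A :|: B) z) f x =
  \esum_(y in slice A z) \esum_(x in slice B y) f x.
Proof.
move=> dAB f0; rewrite -ge0_esum_bigcup//; last first.
  move=> y y' yz y'z [x [xy xy']]; apply/ffunP => j.
  have [jA|jA] := boolP (j \in A); last by rewrite yz// y'z.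
  have jB : j \notin B by exact: dAB.
  by rewrite -xy// xy'.
congr esum; apply/seteqP; split=> [x xz|x [y yz xy] j]; last first.
  by rewrite finset.inE negb_or => /andP[jA jB]; rewrite xy// yz.
exists [ffun j => if j \in A then x j else z j] => j jA; rewrite ffunE.
  by rewrite (negPf jA).
by case: ifPn => // jA'; rewrite xz// finset.inE negb_or jA'.
Qed.

(** Induction on the number of directions. Split off a direction [j] of [A] and apply the induction
    hypothesis on each slice in the other directions. The factor of index [j] is then constant along
    [j] and leaves the sum; the remaining [#|I|.-1] factors are handled by Hölder, and Fubini
    reassembles their slices. *)
Lemma loomis_whitney_slice A z (w : I -> {ffun I -> K} -> \bar R) :
  (1 < #|I|)%N -> (forall i x, (0 <= w i x)%E) ->
  (\esum_(y in slice A z)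
     \prod_i poweR (\esum_(x in slice [set i]%SET y) w i x) (#|I|.-1%:R^-1) <=
   \prod_i poweR (\esum_(x in slice (i |: A) z) w i x) (#|I|.-1%:R^-1))%E.
Proof.
move=> I1 w0; set c : R := _^-1.
have [k] := ubnP #|A|; elim: k A z => // k IHk A z; rewrite ltnS => Ak.
have [->|[j jA]] := finset.set_0Vmem A.
  rewrite slice_set0 esum_set1.
    by under [leRHS]eq_bigr do rewrite finset.setU0.
  by apply: prode_ge0 => *; exact: poweR_ge0.
rewrite -(finset.setD1K jA); set A' := (A :\ j)%SET.
have jA' : j \notin A' by rewrite !finset.inE eqxx.
have prod0 (f : I -> \bar R) (P : pred I) :
    (0 <= \prod_(i | P i) poweR (f i) c)%E.
  by apply: prode_ge0 => *; exact: poweR_ge0.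
rewrite esum_sliceU//; last by move=> l /finset.set1P ->.
have IH y := IHk A' y (leq_trans (proper_card (properD1 jA)) Ak).
apply: (le_trans (le_esum (fun y _ => IH y))).
rewrite (bigD1 j)//= finset.setUA finset.setUid.
have cardj : #|predC1 j| = #|I|.-1 by rewrite cardC1.
have sliceE y : slice [set j]%SET z y -> slice (j |: A')%SET y = slice (j |: A')%SET z.
  move=> yz; apply: slice_eq => l.
  by rewrite finset.in_setU1 negb_or => /andP[lj _]; rewrite yz// finset.in_set1.
under eq_esum => y yz do rewrite (bigD1 j)//= sliceE//.
apply: (le_trans (ge0_esumZl_le _ _ _)) => //; first exact: poweR_ge0.
apply: lee_wpmul2l; first exact: poweR_ge0.
under [leRHS]eq_bigr => i ij.
  rewrite finset.setUCA esum_sliceU//; last first.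
    by move=> l /finset.set1P ->; rewrite finset.in_setU1 negb_or jA' eq_sym ij.
  over.
have := @esum_geomean_le R _ (slice [set j]%SET z) I (predC1 j)
  (fun i y => \esum_(x in slice (i |: A') y) w i x).
rewrite cardj; apply; first by rewrite -subn1 subn_gt0.
by move=> i y; exact: esum_ge0.
Qed.

Lemma loomis_whitney (w : I -> {ffun I -> K} -> \bar R) :
  (1 < #|I|)%N -> (forall i x, (0 <= w i x)%E) ->
  (\esum_(y in [set: {ffun I -> K}])
     \prod_i poweR (\esum_(x in slice [set i]%SET y) w i x) (#|I|.-1%:R^-1) <=
   \prod_i poweR (\esum_(x in [set: {ffun I -> K}]) w i x) (#|I|.-1%:R^-1))%E.
Proof.
move=> I1 w0.
(* A slice needs a base point; if there is none, the left side is an empty sum. *)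
case: (pselect (exists z : {ffun I -> K}, True)) => [[z _]|noz]; last first.
  rewrite esum1; first by apply: prode_ge0 => *; exact: poweR_ge0.
  by move=> z; case: noz; exists z.
have := loomis_whitney_slice [set: I]%SET z I1 w0.
rewrite slice_setT => /le_trans; apply.
apply: lee_prod => i _; rewrite poweR_ge0/=.
by rewrite finset.setUT slice_setT.
Qed.

End LoomisWhitney.

(** * Differences of powers and the Cauchy-Schwarz inequality *)

(** The tangent line at the larger of [x] and [y] gives the bound with its power alone; adding the
    other power makes the bound symmetric. *)
Lemma powR_diff_le (R : realType) (g x y : R) : 1 < g -> 0 <= x -> 0 <= y ->
  `|x `^ g - y `^ g| <= g * (x `^ (g - 1) + y `^ (g - 1)) * `|x - y|.
Proof.
move=> g1; have g0 : 0 < g by lra.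
wlog yx : x y / y <= x => [H x0 y0|x0 y0].
  have [yx|/ltW xy] := leP y x; first exact: H.
  by rewrite distrC [`|x - y|]distrC [_ `^ _ + _]addrC H.
have gn1 : g - 1 != 0 by lra.
(* The tangent line bound [x^g - y^g <= g x^(g-1) (x - y)] is Young's inequality
   for [y * x^(g-1)] with exponents [g] and [g / (g - 1)]. *)
have young : y * x `^ (g - 1) <= y `^ g / g + x `^ g / (g / (g - 1)).
  have := @conjugate_powR R y (x `^ (g - 1)) g (g / (g - 1)) y0 (powR_ge0 _ _) g0.
  rewrite -powRrM (_ : (g - 1) * (g / (g - 1)) = g); last by field.
  by apply; [rewrite divr_gt0//; lra | field; lra].
have xg : x `^ g = x * x `^ (g - 1) by rewrite mulr_powRB1.
have le : x `^ g - y `^ g <= g * x `^ (g - 1) * (x - y).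
  have : g * (y * x `^ (g - 1)) <= y `^ g + (g - 1) * x `^ g.
    apply: (le_trans (ler_wpM2l (ltW g0) young)).
    by rewrite le_eqVlt; apply/orP; left; apply/eqP; field; lra.
  by rewrite xg; lra.
have := ge0_ler_powR (ltW g0) y0 x0 yx => yxg.
rewrite !ger0_norm ?subr_ge0//; apply: (le_trans le).
by rewrite ler_wpM2r ?subr_ge0// ler_wpM2l ?(ltW g0)// lerDl powR_ge0.
Qed.

(** Over the two-element index type [bool], both exponents in [esum_geomean_le] are [1/2]. *)
Lemma esum_cauchy_schwarz (R : realType) (T : choiceType) (D : set T)
    (a b : T -> \bar R) :
  (forall t, (0 <= a t)%E) -> (forall t, (0 <= b t)%E) ->
  (\esum_(t in D) (poweR (a t) 2^-1 * poweR (b t) 2^-1) <=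
   poweR (\esum_(t in D) a t) 2^-1 * poweR (\esum_(t in D) b t) 2^-1)%E.
Proof.
move=> a0 b0.
have := @esum_geomean_le R T D bool predT (fun i => if i then a else b).
rewrite card_bool => /(_ isT) H.
have {H} := H _; rewrite (big_bool mule)/=.
under eq_esum do rewrite (big_bool mule)/=.
by apply=> -[].
Qed.

(** * Lattice lines: decay, telescoping and differences of powers *)

Section Lattice.
Context {R : realType} {n : nat}.
Implicit Types (z : @zpoint n) (i : 'I_n).

(** Translation acts on integer coordinates, so the inequalities of this part do not see the mesh
    sizes. *)
Definition zshift i (k : int) z : @zpoint n :=
  [ffun j => z j + (if j == i then k else 0)].

Lemma zshift0 i z : zshift i 0 z = z.
Proof. by apply/ffunP => j; rewrite ffunE if_same addr0. Qed.

Lemma zshiftD i k l z : zshift i k (zshift i l z) = zshift i (l + k) z.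
Proof. by apply/ffunP => j; rewrite !ffunE -addrA; case: ifP; rewrite ?addr0. Qed.

Lemma zshift_inj i z : injective (fun k => zshift i k z).
Proof. by move=> k l /ffunP/(_ i); rewrite !ffunE eqxx => /addrI. Qed.

Lemma zshift_slice i k z : slice [set i]%SET z (zshift i k z).
Proof. by move=> j; rewrite ffunE finset.in_set1 => /negPf ->; rewrite addr0. Qed.

Lemma esum_zshift i k (f : @zpoint n -> \bar R) :
  \esum_(z in [set: @zpoint n]) f (zshift i k z) = \esum_(z in [set: @zpoint n]) f z.
Proof.
rewrite [RHS](reindex_esum [set: @zpoint n] _ (zshift i k))//; split=> //.
  move=> x y _ _ /(congr1 (zshift i (- k))).
  by rewrite !zshiftD subrr !zshift0.
move=> z _; exists (zshift i (- k) z) => //.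
by rewrite zshiftD addNr zshift0.
Qed.

(** The points of the forward ray from [z] are distinct and lie on the line through [z]. *)
Lemma sum_zshift_le_esum i z (f : @zpoint n -> \bar R) N :
  (forall y, (0 <= f y)%E) ->
  (\sum_(k < N) f (zshift i k%:Z z) <= \esum_(y in slice [set i]%SET z) f y)%E.
Proof.
move=> f0; pose e (k : nat) := zshift i k%:Z z.
have einj : set_inj xpredT e by move=> k l _ _ /zshift_inj [].
apply: (@le_trans _ _ (\esum_(y in e @` xpredT) f y)); last first.
  by apply: esum_subset_le => _ [k _ <-]; exact: zshift_slice.
rewrite esum_pred_image// -(big_mkord xpredT (fun k => f (e k))).
by apply: nneseries_lim_ge => k _ _.
Qed.

(** If [f] exceeded [e] on the whole forward ray, the first [N] points would contribute at least
    [N * e^r], which is unbounded in [N]. *)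
Lemma line_small i z (f : @zpoint n -> R) (r e : R) :
  (forall y, 0 <= f y) -> 0 < r -> 0 < e ->
  (\esum_(y in [set: @zpoint n]) (f y `^ r)%:E < +oo)%E ->
  exists N : nat, f (zshift i N%:Z z) <= e.
Proof.
move=> f0 r0 e0 fin; apply: contrapT => /forallNP big.
have er0 : 0 < e `^ r by rewrite powR_gt0.
set S := (\esum_(y in _) _)%E in fin.
have S0 : (0 <= S)%E by apply: esum_ge0 => y _; rewrite lee_fin powR_ge0.
have Sfin : S \is a fin_num by rewrite ge0_fin_numE.
pose N := Num.bound (fine S / e `^ r).
have : fine S < N%:R * e `^ r.
  by rewrite -ltr_pdivrMr// /N archi_boundP// divr_ge0 ?fine_ge0// ltW.
apply/negP; rewrite -leNgt -lee_fin fineK//.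
apply: (@le_trans _ _ (\sum_(k < N) (f (zshift i k%:Z z) `^ r)%:E)%E).
  rewrite sumEFin lee_fin -[N in leLHS]card_ord mulr_natl -sumr_const ler_sum// => k _.
  by rewrite (ge0_ler_powR (ltW r0)) ?nnegrE ?(ltW e0)// ltW// ltNge; apply/negP.
apply: (le_trans (@sum_zshift_le_esum i z (fun y => (f y `^ r)%:E) N _)).
  by move=> y; rewrite lee_fin powR_ge0.
exact: esum_subset_le.
Qed.

(** Telescoping from [z] to a far point of the forward ray, where [f] is at most an arbitrary
    [e > 0]. *)
Lemma le_esum_line i z (f : @zpoint n -> R) (r : R) :
  (forall y, 0 <= f y) -> 0 < r ->
  (\esum_(y in [set: @zpoint n]) (f y `^ r)%:E < +oo)%E ->
  ((f z)%:E <= \esum_(y in slice [set i]%SET z) `|f (zshift i 1 y) - f y|%:E)%E.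
Proof.
move=> f0 r0 fin; apply/lee_addgt0Pr => e e0.
have [N fN] := line_small i z f0 r0 e0 fin.
rewrite addeC; apply: (@le_trans _ _
  (e%:E + \sum_(k < N) `|f (zshift i 1 (zshift i k%:Z z)) - f (zshift i k%:Z z)|%:E)%E).
  rewrite sumEFin -EFinD lee_fin; apply: le_trans (lerD fN (lexx _)).
  elim: {fN} N => [|N IH]; first by rewrite big_ord0 zshift0 addr0.
  rewrite big_ord_recr/= zshiftD -PoszD addn1.
  apply: (le_trans IH); rewrite [leRHS]addrCA [leLHS]addrC lerD2l.
  by rewrite addrC -lerBlDr (le_trans (ler_norm _))// distrC.
rewrite leeD2l//.
by apply: (@sum_zshift_le_esum i z (fun y => `|f (zshift i 1 y) - f y|%:E)).
Qed.

Lemma esum_diff_powR_le i (a : @zpoint n -> R) (g : R) :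
  1 < g -> (forall z, 0 <= a z) ->
  (\esum_(z in [set: @zpoint n]) `|a (zshift i 1 z) `^ g - a z `^ g|%:E <=
   (2 * g)%:E * (poweR (\esum_(z in [set: @zpoint n]) (a z `^ (2 * (g - 1)))%:E) 2^-1
     * poweR (\esum_(z in [set: @zpoint n]) (`|a (zshift i 1 z) - a z| ^+ 2)%:E) 2^-1))%E.
Proof.
move=> g1 a0; have g0 : 0 < g by lra.
pose d z : R := `|a (zshift i 1 z) - a z|.
have d0 z : 0 <= d z by exact: normr_ge0.
(* This is [b z ^ (g - 1) * d z] as a product of square roots, ready for Cauchy-Schwarz; it serves
   for [a] and for its shift. *)
pose t (b : @zpoint n -> R) z := (poweR (b z `^ (2 * (g - 1)))%:E 2^-1 * poweR (d z ^+ 2)%:E 2^-1)%E.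
have tE b z : t b z = (b z `^ (g - 1) * d z)%:E.
  rewrite /t !poweR_EFin -EFinM -powRrM mulrAC mulfV// mul1r.
  by rewrite -(powR_mulrn 2 (d0 z)) -powRrM mulfV// powRr1.
have t0 b z : (0 <= t b z)%E by rewrite tE lee_fin mulr_ge0// powR_ge0.
apply: (@le_trans _ _ (\esum_(z in [set: @zpoint n])
    (g%:E * (t (a \o zshift i 1) z + t a z)))%E).
  apply: le_esum => z _; rewrite !tE -EFinD -EFinM lee_fin -mulrDl mulrA.
  exact: powR_diff_le.
apply: (le_trans (ge0_esumZl_le _ _ _)).
- by rewrite lee_fin ltW.
- by move=> z; rewrite adde_ge0.
rewrite mulrC EFinM -muleA lee_wpmul2l ?lee_fin ?(ltW g0)//.
rewrite esumD// -[2]/(1 + 1) EFinD ge0_muleDl// mul1e leeD//.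
(* Translation invariance gives the shifted term the same bound as the other one, whence the factor
   [2]. *)
- rewrite -[X in (_ <= poweR X _ * _)%E](esum_zshift i 1).
  by apply: esum_cauchy_schwarz => z; rewrite lee_fin ?powR_ge0 ?exprn_ge0.
- by apply: esum_cauchy_schwarz => z; rewrite lee_fin ?powR_ge0 ?exprn_ge0.
Qed.

End Lattice.

(** * Recombining the mesh sizes and solving for the sum *)

Lemma ge0_esumZl (R : realType) (T : choiceType) (D : set T) (c : R)
    (f : T -> \bar R) : 0 < c -> (forall t, (0 <= f t)%E) ->
  (\esum_(t in D) (c%:E * f t) = c%:E * \esum_(t in D) f t)%E.
Proof.
move=> c0 f0; apply/le_anti/andP; split.
  by apply: ge0_esumZl_le => //; rewrite lee_fin ltW.
rewrite -lee_pdivlMl//.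
apply: le_trans (ge0_esumZl_le _ _ _); last 2 first.
- by rewrite lee_fin invr_ge0 ltW.
- by move=> t; rewrite mule_ge0// lee_fin ltW.
by apply: le_esum => t _; rewrite muleA -EFinM mulVf ?gt_eqF// mul1e.
Qed.

(** Here [k.+2] is the dimension [n]. With [V = hvol h], raising to the power [n - 1] and squaring
    gives [s^(2n-2) <= s^n / V^(n-2) * Q], where [Q] is the product of the [(2g)^2 e_i], because the
    [h_i^2] multiply to [V^2]. Cancelling [s^n] leaves [(s V)^(n-2) <= Q], and AM-GM bounds [Q]. *)
Lemma sobolev_algebra (R : realType) (k : nat) (s g : R) (h e : 'I_k.+2 -> R) :
  (0 < k)%N -> 0 <= s -> 0 <= g -> (forall i, 0 < h i) -> (forall i, 0 <= e i) ->
  s <= \prod_i (2 * g * (s `^ 2^-1 * (h i ^+ 2 / hvol h * e i) `^ 2^-1))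
         `^ (k.+1%:R^-1) ->
  (s * hvol h) ^+ k <= ((2 * g) ^+ 2 / k.+2%:R * \sum_i e i) ^+ k.+2.
Proof.
move=> k0 s0 g0 h0 e0.
have V0 : 0 < hvol h by apply: prodr_gt0.
have AGM : \prod_i ((2 * g) ^+ 2 * e i) <=
    ((2 * g) ^+ 2 / k.+2%:R * \sum_i e i) ^+ k.+2.
  have [+ _] := @leif_AGM R _ (mem 'I_k.+2) (fun i => (2 * g) ^+ 2 * e i)
    (fun i _ => mulr_ge0 (sqr_ge0 _) (e0 i)).
  by rewrite card_ord -mulr_sumr mulrAC.
(* The case [s = 0] is separate because a power of [s] is cancelled below. *)
move: s0; rewrite le_eqVlt => /predU1P[<- _|s0].
  rewrite mul0r expr0n gtn_eqF// exprn_ge0// mulr_ge0 ?sumr_ge0//.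
  by rewrite divr_ge0// sqr_ge0.
pose x i := 2 * g * (s `^ 2^-1 * (h i ^+ 2 / hvol h * e i) `^ 2^-1).
have x0 i : 0 <= x i by rewrite !mulr_ge0// powR_ge0.
rewrite (powR_prod (P := predT) (x := x))// => H.
have {H}H : s ^+ k.+1 <= \prod_i x i.
  have P0 : 0 <= \prod_i x i by exact: prodr_ge0.
  have -> : \prod_i x i = ((\prod_i x i) `^ (k.+1%:R^-1)) ^+ k.+1.
    by rewrite -(powR_mulrn k.+1 (powR_ge0 _ _)) -powRrM mulVf ?powRr1// pnatr_eq0.
  by rewrite lerXn2r ?nnegrE ?powR_ge0 ?(ltW s0).
apply: le_trans AGM.
have sq (y : R) : 0 <= y -> (y `^ 2^-1) ^+ 2 = y.
  by move=> y0; rewrite -(powR_mulrn 2 (powR_ge0 _ _)) -powRrM mulVf// powRr1.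
have {H} : (s ^+ k.+1) ^+ 2 <= (\prod_i x i) ^+ 2.
  by rewrite lerXn2r ?nnegrE ?exprn_ge0 ?(ltW s0) ?prodr_ge0.
rewrite -prodrXl (eq_bigr (fun i => s / hvol h * h i ^+ 2 * ((2 * g) ^+ 2 * e i))); last first.
  move=> i _; rewrite /x exprMn [X in _ * X]exprMn !sq ?(ltW s0)//.
    by field; rewrite gt_eqF.
  by rewrite mulr_ge0// divr_ge0 ?sqr_ge0// ltW.
rewrite big_split/= [X in X * _]big_split/= prodr_const card_ord prodrXl -/(hvol h).
set Q := (X in _ <= _ * X -> _); move=> H.
have c0 : 0 < s ^+ k.+2 / hvol h ^+ k by rewrite divr_gt0// exprn_gt0.
rewrite -(ler_pM2l c0); apply: le_trans (le_trans H _).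
  rewrite exprMn mulrACA mulVf ?gt_eqF ?exprn_gt0// mulr1 -exprD -exprM.
  by rewrite muln2 -addnn addSn addnS.
rewrite [(s / _) ^+ _]exprMn exprVn le_eqVlt; apply/orP; left; apply/eqP; congr (_ * _).
rewrite -mulrA; congr (_ * _).
have -> : hvol h ^+ k.+2 = hvol h ^+ k * hvol h ^+ 2 by rewrite -exprD addn2.
by rewrite invfM divfK// gt_eqF// exprn_gt0.
Qed.

Lemma lee_poweR (R : realType) (r : R) (x y : \bar R) :
  0 <= r -> (0 <= x)%E -> (x <= y)%E -> (poweR x r <= poweR y r)%E.
Proof.
move=> r0 x0 xy; apply: (gt0_ler_poweR r0 _ _ xy); rewrite in_itv/= leey andbT//.
exact: le_trans xy.
Qed.

(** * The discrete Gagliardo-Nirenberg inequality in [l^1] *)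

(** The power [n/(n-1)] of [f z] is a product of [n] factors [f z ^ (1/(n-1))], one per direction;
    each is bounded by its line sum, and Loomis-Whitney sums the product. Finiteness supplies the
    decay along lines. *)
Lemma gagliardo_l1 (R : realType) (k : nat) (f : @zpoint k.+2 -> R) :
  (forall z, 0 <= f z) ->
  (\esum_(z in [set: @zpoint k.+2]) (f z `^ (k.+2%:R / k.+1%:R))%:E < +oo)%E ->
  (\esum_(z in [set: @zpoint k.+2]) (f z `^ (k.+2%:R / k.+1%:R))%:E <=
   \prod_i poweR (\esum_(z in [set: @zpoint k.+2]) `|f (zshift i 1 z) - f z|%:E)
     (k.+1%:R^-1))%E.
Proof.
move=> f0 fin; set r := k.+2%:R / k.+1%:R in fin *.
have r0 : 0 < r by rewrite divr_gt0.
have := @loomis_whitney R 'I_k.+2 int (fun i z => `|f (zshift i 1 z) - f z|%:E).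
rewrite card_ord => /(_ isT (fun _ _ => _)) LW.
apply: le_trans (LW _); last by move=> i z; rewrite lee_fin.
apply: le_esum => z _.
have -> : (f z `^ r)%:E = (\prod_(i < k.+2) poweR (f z)%:E (k.+1%:R^-1))%E.
  under eq_bigr do rewrite poweR_EFin.
  rewrite prodEFin prodr_const card_ord -powR_mulrn ?powR_ge0//.
  by rewrite -powRrM mulrC.
apply: lee_prod => i _; rewrite poweR_ge0/=.
rewrite -poweR_EFin.
by apply: lee_poweR; rewrite ?invr_ge0 ?lee_fin//; apply: le_esum_line r0 fin.
Qed.

(** * The numerical constant and the Sobolev inequality *)

Lemma C_S_le5 (R : realType) (n : nat) : (3 <= n)%N -> @C_S R n <= 5.
Proof.
case: n => [|[|k]]//; rewrite 2!ltnS => k0; rewrite /C_S.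
have k1 : 1 <= k%:R :> R by rewrite ler1n.
rewrite -[k.+2]addn2 natrD addrK; set t : R := k%:R in k1 *.
have -> : t + 2 - 1 = t + 1 by lra.
have sq0 : 0 < Num.sqrt (t + 2) by rewrite sqrtr_gt0; lra.
have D0 : 0 < Num.sqrt (t + 2) * t by rewrite mulr_gt0//; lra.
rewrite ler_pdivrMr// -ler_sqr ?nnegrE; last 2 first.
- lra.
- by rewrite mulr_ge0// ltW.
(* The squared claim is [16 (t+1)^2 <= 25 (t+2) t^2], which holds for [t >= 1]. *)
by rewrite !exprMn sqr_sqrtr; nra.
Qed.

Theorem mainTheorem6 (R : realType) (n : nat) (hn : (3 <= n)%N) :
  (@C_S R n <= 5) /\
  forall (h : 'I_n -> R), (forall i, 0 < h i) ->
  forall u : ('I_n -> R) -> R, in_D12 h u ->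
  (lattice_Lnorm h u (@sob_exp R n) <= (@C_S R n)%:E * lattice_Dnorm h u)%E.
Proof.
split; first exact: C_S_le5.
case: n hn => [|[|k]]//; rewrite 2!ltnS => k0 h h0 u [Lfin Dfin].
have kR : 0 < k%:R :> R by rewrite ltr0n.
have nE : k.+2%:R - 2 = k%:R :> R by rewrite -addn2 natrD addrK.
have n1E : k.+2%:R - 1 = k.+1%:R :> R by rewrite -natr1 addrK.
pose p := @sob_exp R k.+2; pose g : R := 2 * k.+1%:R / k%:R.
have pE : p = 2 * k.+2%:R / k%:R by rewrite /p /sob_exp nE.
have k1E : k.+1%:R = k%:R + 1 :> R by rewrite -natr1.
have k2E : k.+2%:R = k%:R + 2 :> R by rewrite -addn2 natrD.
have p0 : 0 < p by rewrite pE divr_gt0// mulr_gt0.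
have g1 : 1 < g by rewrite /g ltr_pdivlMr// k1E; lra.
have pg : 2 * (g - 1) = p by rewrite pE /g k1E k2E; field; rewrite !gt_eqF// ltr_wpDl// ltW.
have gp : g * (k.+2%:R / k.+1%:R) = p by rewrite pE /g k1E k2E; field; rewrite !gt_eqF// ltr_wpDl// ltW.
have V0 : 0 < hvol h by apply: prodr_gt0.
pose a z := `|u (lpt h z)|.
have a0 z : 0 <= a z by exact: normr_ge0.
pose S := \esum_(z in [set: @zpoint k.+2]) (a z `^ p)%:E.
pose E i := \esum_(z in [set: @zpoint k.+2])
  (`|Dplus h u i (lpt h z)| ^+ 2 * hvol h)%:E.
have E0 i : (0 <= E i)%E.
  by apply: esum_ge0 => z _; rewrite lee_fin mulr_ge0 ?sqr_ge0 ?(ltW V0).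
have S0 : (0 <= S)%E by apply: esum_ge0 => z _; rewrite lee_fin powR_ge0.
have LE : lattice_Lnorm h u p = poweR ((hvol h)%:E * S)%E p^-1.
  rewrite /lattice_Lnorm -ge0_esumZl//; last first.
    by move=> z; rewrite lee_fin powR_ge0.
  by congr poweR; apply: eq_esum => z _; rewrite -EFinM mulrC.
(* A power with nonzero exponent is finite only if its base is. *)
have SVfin : ((hvol h)%:E * S < +oo)%E.
  by rewrite (@lty_poweRy _ _ p^-1)// ?invr_neq0 ?gt_eqF// -LE.
have Sfin : S \is a fin_num.
  rewrite ge0_fin_numE// ltey; apply/eqP => Sy.
  by move: SVfin; rewrite Sy gt0_muley ?lte_fin.
pose s := fine S; have SE : S = s%:E by rewrite fineK.
have s0 : 0 <= s by rewrite fine_ge0.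
have Efin i : E i \is a fin_num.
  have : (\sum_(i < k.+2) E i < +oo)%E by exact: (@lty_poweRy _ _ 2^-1).
  rewrite ge0_fin_numE//; apply: le_lt_trans.
  by rewrite (bigD1 i)//= leeDl// sume_ge0.
pose e i := fine (E i); have EE i : E i = (e i)%:E by rewrite fineK.
have e0 i : 0 <= e i by rewrite fine_ge0.
have shiftE i z : (fun j => lpt h z j + (if j == i then h i else 0)) = lpt h (zshift i 1 z).
  apply/funext => j; rewrite /lpt ffunE; case: eqP => [->|_].
    by rewrite intrD mulrDr mulr1.
  by rewrite !addr0.
pose G i := \esum_(z in [set: @zpoint k.+2]) (`|a (zshift i 1 z) - a z| ^+ 2)%:E.
(* The factor [h_i^2 / hvol h] removes the division by [h_i] in [Dplus] and the volume weight;
   passing from [u] to [|u|] is the reverse triangle inequality. *)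
have GE i : (G i <= (h i ^+ 2 / hvol h * e i)%:E)%E.
  rewrite EFinM -EE -ge0_esumZl; last 2 first.
  - by rewrite divr_gt0// exprn_gt0.
  - by move=> z; rewrite lee_fin mulr_ge0 ?sqr_ge0 ?(ltW V0).
  apply: le_esum => z _; rewrite -EFinM lee_fin /Dplus shiftE.
  rewrite normrM normfV (gtr0_norm (h0 i)) exprMn exprVn.
  rewrite [leRHS](_ : _ = `|u (lpt h (zshift i 1 z)) - u (lpt h z)| ^+ 2).
    by rewrite lerXn2r ?nnegrE// ler_dist_dist.
  by field; rewrite !gt_eqF.
have W i : (\esum_(z in [set: @zpoint k.+2]) `|a (zshift i 1 z) `^ g - a z `^ g|%:E <=
    (2 * g * (s `^ 2^-1 * (h i ^+ 2 / hvol h * e i) `^ 2^-1))%:E)%E.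
  have g0 : 0 <= g by lra.
  apply: (le_trans (esum_diff_powR_le i g1 a0)); rewrite pg -/S SE [leRHS]EFinM.
  rewrite lee_wpmul2l ?lee_fin ?mulr_ge0// EFinM -!poweR_EFin.
  rewrite lee_wpmul2l ?poweR_ge0//.
  apply: lee_poweR (GE i); rewrite ?invr_ge0//.
  by apply: esum_ge0 => z _; rewrite lee_fin sqr_ge0.
have := @gagliardo_l1 R k (fun z => a z `^ g) (fun z => powR_ge0 _ _).
under eq_esum do rewrite -powRrM gp.
rewrite -/S => /(_ _) GL.
have {GL} : (S <= \prod_(i < k.+2) poweR
    (2 * g * (s `^ 2^-1 * (h i ^+ 2 / hvol h * e i) `^ 2^-1))%:E (k.+1%:R^-1))%E.
  apply: le_trans (GL _) _; first by rewrite SE ltry.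
  apply: lee_prod => i _; rewrite poweR_ge0/=.
  apply: lee_poweR (W i); rewrite ?invr_ge0//.
  by apply: esum_ge0 => z _; rewrite lee_fin.
under eq_bigr do rewrite poweR_EFin.
rewrite prodEFin SE lee_fin => /(sobolev_algebra k0 s0 _ h0 e0) main.
have {}main := main (ltW (lt_trans ltr01 g1)).
rewrite -/p LE SE /lattice_Dnorm (eq_bigr _ (fun i _ => EE i)) sumEFin -EFinM.
rewrite !poweR_EFin -EFinM lee_fin.
have e_ge0 : 0 <= \sum_i e i by exact: sumr_ge0.
(* The power [q = 1/(2n)] turns the exponents [n - 2] and [n] of [main] into [1/p] and [1/2]. *)
set q : R := (2 * k.+2%:R)^-1.
have sn0 : 0 < Num.sqrt k.+2%:R :> R by rewrite sqrtr_gt0.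
have CE : @C_S R k.+2 = 2 * g / Num.sqrt k.+2%:R.
  by rewrite /C_S nE n1E /g; field; rewrite !gt_eqF.
have -> : (hvol h * s) `^ p^-1 = ((s * hvol h) ^+ k) `^ q.
  rewrite mulrC -powR_mulrn ?mulr_ge0 ?(ltW V0)// -powRrM; congr (_ `^ _).
  by rewrite pE /q; field; rewrite !gt_eqF.
have C0 : 0 <= @C_S R k.+2 by rewrite CE divr_ge0 ?(ltW sn0)//; lra.
have -> : @C_S R k.+2 * (\sum_i e i) `^ 2^-1 =
   (((2 * g) ^+ 2 / k.+2%:R * \sum_i e i) ^+ k.+2) `^ q.
  have -> : (2 * g) ^+ 2 / k.+2%:R = (@C_S R k.+2) ^+ 2.
    by rewrite CE expr_div_n sqr_sqrtr.
  rewrite -powR_mulrn ?mulr_ge0 ?sqr_ge0// -powRrM.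
  rewrite (_ : k.+2%:R * q = 2^-1); last by rewrite /q; field; rewrite gt_eqF.
  by rewrite powRM ?sqr_ge0// -powR_mulrn// -powRrM mulfV// powRr1.
apply: ge0_ler_powR main; rewrite ?nnegrE ?invr_ge0 ?exprn_ge0//.
  by rewrite mulr_ge0// ltW.
by rewrite mulr_ge0// divr_ge0// sqr_ge0.
Qed.
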